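(* Let $m\ge n\ge 1$ and let $f\colon\mathbb{R}^{m\times n}\to\mathbb{R}\cup\{+\infty\}$ be $L$-Lipschitz smooth and $\mu$-Polyak–Łojasiewicz with $L,\mu\in(0,\infty)$, with $f^\star=\min f$ and $\kappa_H=L/\mu$. Let $(X_k)$ be generated from any $X_0\in\mathbb{R}^{m\times n}$ by the exact PolarGrad iteration $$X_{k+1}=X_k-\gamma_k\,\mathrm{tr}(H_k)\,U_k,$$ where $U_k$ and $H_k$ are the orthogonal and symmetric polar factors of $G_k=\nabla f(X_k)$, and $\gamma_k=1/(Lr_k)$ with $r_k=\mathrm{rank}(G_k)$. Then for every $k$ with $G_k\neq 0$, $$f(X_{k+1})-f^\star\le\Bigl(1-\frac{1}{r_k\,\kappa_H}\Bigr)\bigl(f(X_k)-f^\star\bigr)$$ and $$f(X_{k+1})-f^\star\le\Bigl(1-\frac{1}{\kappa_{G_k}^2\,\kappa_H}\Bigr)\bigl(f(X_k)-f^\star\bigr),$$ where $\kappa_{G_k}=\sigma_1(G_k)/\sigma_{r_k}(G_k)$ is the ratio of the largest to the smallest positive singular value of $G_k$.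
   Context: $\|\cdot\|_F$ is the Frobenius norm and $\langle A,B\rangle_F=\mathrm{tr}(A^\top B)$. $f$ is $L$-Lipschitz smooth if it is finite and differentiable everywhere and $\|\nabla f(X)-\nabla f(Y)\|_F\le L\|X-Y\|_F$ for all $X,Y\in\mathbb{R}^{m\times n}$. $f$ is $\mu$-Polyak–Łojasiewicz if $\|\nabla f(X)\|_F^2\ge 2\mu(f(X)-f^\star)$ for all $X$, where $f^\star=\min f$ (the minimum is assumed attained). No convexity is assumed. Polar factors: if $G\in\mathbb{R}^{m\times n}$ has rank $r$ and compact singular value decomposition $G=\sum_{i=1}^{r}\sigma_iu_iv_i^\top$ with $\sigma_1\ge\dots\ge\sigma_r>0$, its orthogonal polar factor is $U=\sum_{i=1}^{r}u_iv_i^\top$ and its symmetric polar factor is $H=(G^\top G)^{1/2}=\sum_{i=1}^r\sigma_iv_iv_i^\top$, so that $G=UH$ and $\mathrm{tr}(H)=\sum_i\sigma_i$ is the nuclear norm of $G$. *)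

(* Defs.v *)
From HB Require Import structures.
From mathcomp Require Import all_boot all_order all_algebra.
From mathcomp Require Import all_classical all_reals all_analysis.
Set Implicit Arguments.
Unset Strict Implicit.
Unset Printing Implicit Defensive.
Import Order.TTheory GRing.Theory Num.Theory.
Import numFieldNormedType.Exports.
Local Open Scope ring_scope.

Definition frob_dot (R : realType) (m n : nat) (A B : 'M[R]_(m, n)) : R :=
  \tr (A^T *m B).

Definition frob_norm (R : realType) (m n : nat) (A : 'M[R]_(m, n)) : R :=
  Num.sqrt (frob_dot A A).

Definition gradient (R : realType) (m n : nat) (f : 'M[R]_(m, n) -> R)
    (X : 'M[R]_(m, n)) : 'M[R]_(m, n) :=
  \matrix_(i, j) 'D_(delta_mx i j) f X.

(* The library norms matrices by the maximum of their entries; differentiability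
   does not depend on the norm, and the gradient represents the differential
   for the Frobenius inner product. *)
Lemma frob_dot_gradient (R : realType) (m n : nat) (f : 'M[R]_(m, n) -> R)
    (X V : 'M[R]_(m, n)) :
  differentiable f X -> frob_dot (gradient f X) V = 'd f X V.
Proof.
move=> df; rewrite {2}[V]matrix_sum_delta linear_sum /frob_dot /mxtrace.
under eq_bigr do rewrite mxE.
rewrite exchange_big /=; apply: eq_bigr => i _; rewrite linear_sum.
by apply: eq_bigr => j _; rewrite !mxE linearZ deriveE // mulrC.
Qed.

Definition lipschitz_smooth (R : realType) (m n : nat) (L : R)
    (f : 'M[R]_(m, n) -> \bar R) : Prop :=
  [/\ forall X, f X \is a fin_num,
      forall X, differentiable (fine \o f) X &
      forall X Y, frob_norm (gradient (fine \o f) X - gradient (fine \o f) Y)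
                  <= L * frob_norm (X - Y)].

Definition is_min (R : realType) (T : Type) (f : T -> \bar R) (fstar : \bar R)
    : Prop :=
  (exists X, f X = fstar) /\ (forall X, (fstar <= f X)%E).

Definition polyak_lojasiewicz (R : realType) (m n : nat) (mu : R)
    (f : 'M[R]_(m, n) -> \bar R) (fstar : \bar R) : Prop :=
  is_min f fstar /\
  forall X, ((2 * mu)%:E * (f X - fstar)
             <= (frob_norm (gradient (fine \o f) X) ^+ 2)%:E)%E.

(* A rank-zero matrix has the empty decomposition. The vectors u_i and v_i are the columns of [lsv] and [rsv], and sigma_i is
   entry number i - 1 of [sv]. *)
Record compact_svd (R : realType) (m n : nat) (G : 'M[R]_(m, n)) := CompactSVD {
  lsv : 'M[R]_(m, \rank G);
  sv : (\rank G).-tuple R;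
  rsv : 'M[R]_(n, \rank G);
  lsv_orthonormal : lsv^T *m lsv = 1%:M;
  rsv_orthonormal : rsv^T *m rsv = 1%:M;
  sv_sorted : sorted >=%R sv;
  sv_gt0 : forall i, 0 < tnth sv i;
  svdE : G = \sum_i tnth sv i *: (col i lsv *m (col i rsv)^T) }.

(* The polar factors and the singular values of G do not depend on the
   decomposition S they are read off from. *)
Section Polar.
Variables (R : realType) (m n : nat) (G : 'M[R]_(m, n)) (S : compact_svd G).

Definition orth_polar : 'M[R]_(m, n) :=
  \sum_i col i (lsv S) *m (col i (rsv S))^T.

Definition sym_polar : 'M[R]_n :=
  \sum_i tnth (sv S) i *: (col i (rsv S) *m (col i (rsv S))^T).

Definition svd_cond : R := (sv S)`_0 / (sv S)`_(\rank G).-1.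

Lemma tr_col_rsv i j : (col i (rsv S))^T *m col j (rsv S) = (i == j)%:R%:M.
Proof.
apply/matrixP => a b; rewrite !ord1 [RHS]mxE mulr1n.
have /matrixP/(_ i j) := rsv_orthonormal S; rewrite !mxE => <-.
by apply: eq_bigr => k _; rewrite !mxE.
Qed.

Lemma tr_col_lsv i j : (col i (lsv S))^T *m col j (lsv S) = (i == j)%:R%:M.
Proof.
apply/matrixP => a b; rewrite !ord1 [RHS]mxE mulr1n.
have /matrixP/(_ i j) := lsv_orthonormal S; rewrite !mxE => <-.
by apply: eq_bigr => k _; rewrite !mxE.
Qed.

Lemma polarE : G = orth_polar *m sym_polar.
Proof.
rewrite [LHS](svdE S) mulmx_suml; apply: eq_bigr => i _.
rewrite mulmx_sumr (bigD1 i) //= -scalemxAr -mulmxA (mulmxA (_^T)) tr_col_rsv.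
rewrite eqxx mul1mx big1 ?addr0// => j jNi.
rewrite -scalemxAr -mulmxA (mulmxA (_^T)) tr_col_rsv eq_sym (negbTE jNi).
by rewrite -scalemx1 scale0r mul0mx mulmx0 scaler0.
Qed.

Lemma sym_polar_sym : sym_polar^T = sym_polar.
Proof.
rewrite /sym_polar linear_sum; apply: eq_bigr => i _.
by rewrite linearZ /= trmx_mul trmxK.
Qed.

Lemma sym_polar_psd (x : 'cV[R]_n) : 0 <= (x^T *m sym_polar *m x) 0 0.
Proof.
rewrite mulmx_sumr mulmx_suml summxE sumr_ge0 // => i _.
rewrite -scalemxAr -scalemxAl mxE mulr_ge0 ?(ltW (sv_gt0 S i)) //.
set v := col i _; have -> : x^T *m (v *m v^T) *m x = (v^T *m x)^T *m (v^T *m x).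
  by rewrite trmx_mul trmxK !mulmxA.
by rewrite mxE big_ord1 [X in X * _]mxE -expr2 sqr_ge0.
Qed.

Lemma sym_polar_sqr : sym_polar *m sym_polar = G^T *m G.
Proof.
have -> : G^T *m G = sym_polar *m (orth_polar^T *m G).
  by rewrite {1}polarE trmx_mul sym_polar_sym mulmxA.
congr (_ *m _); rewrite [X in _ *m X](svdE S) mulmx_sumr.
apply: eq_bigr => i _; rewrite -scalemxAr; congr (_ *: _).
rewrite mulmxA linear_sum mulmx_suml /= (bigD1 i) //= trmx_mul trmxK -mulmxA.
rewrite tr_col_lsv eqxx mulmx1 big1 ?addr0// => j jNi.
rewrite trmx_mul trmxK -mulmxA tr_col_lsv (negbTE jNi).
by rewrite -scalemx1 scale0r mulmx0.
Qed.

End Polar.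

(* Main.v *)
(** Along the segment from X to X + V, L-smoothness gives the descent inequality
    f (X + V) <= f X + <grad f X, V> + L/2 |V|^2. With V = - gamma tr(H) U,
    <G, U> = tr H and |U|^2 = rank G, the choice gamma = 1/(L r) yields the
    decrease (tr H)^2 / (2 L r). The Polyak-Lojasiewicz inequality then reduces
    both rates to lower bounds on (tr H)^2 / r in terms of
    |G|^2 = sum_i sigma_i^2: the first is (sum_i sigma_i)^2 >= sum_i sigma_i^2,
    the second is tr H >= r sigma_r together with |G|^2 <= r sigma_1^2. *)
Require Import Defs.
From mathcomp Require Import all_boot all_order all_algebra.
From mathcomp Require Import all_classical all_reals all_analysis.
From mathcomp Require Import ring lra.
Import Order.TTheory GRing.Theory Num.Theory.
Import numFieldNormedType.Exports.
Local Open Scope ring_scope.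

(** * Bilinear algebra of the Frobenius inner product *)

Lemma frob_dotC {R : realType} {m n : nat} (A B : 'M[R]_(m, n)) :
  frob_dot A B = frob_dot B A.
Proof. by rewrite /frob_dot -mxtrace_tr trmx_mul trmxK. Qed.

Lemma frob_dotDl {R : realType} {m n : nat} (A B C : 'M[R]_(m, n)) :
  frob_dot (A + B) C = frob_dot A C + frob_dot B C.
Proof. by rewrite /frob_dot linearD mulmxDl linearD. Qed.

Lemma frob_dotZl {R : realType} {m n : nat} (a : R) (A C : 'M[R]_(m, n)) :
  frob_dot (a *: A) C = a * frob_dot A C.
Proof. by rewrite /frob_dot linearZ /= -scalemxAl linearZ. Qed.

Lemma frob_dotDr {R : realType} {m n : nat} (A B C : 'M[R]_(m, n)) :
  frob_dot C (A + B) = frob_dot C A + frob_dot C B.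
Proof. by rewrite !(frob_dotC C) frob_dotDl. Qed.

Lemma frob_dotZr {R : realType} {m n : nat} (a : R) (A C : 'M[R]_(m, n)) :
  frob_dot C (a *: A) = a * frob_dot C A.
Proof. by rewrite !(frob_dotC C) frob_dotZl. Qed.

Lemma frob_dot_suml {R : realType} {m n r : nat} (E : 'I_r -> 'M[R]_(m, n))
    (C : 'M[R]_(m, n)) :
  frob_dot (\sum_i E i) C = \sum_i frob_dot (E i) C.
Proof. by rewrite /frob_dot raddf_sum mulmx_suml raddf_sum. Qed.

Lemma frob_dot_ge0 {R : realType} {m n : nat} (A : 'M[R]_(m, n)) :
  0 <= frob_dot A A.
Proof.
rewrite /frob_dot sumr_ge0 // => i _; rewrite mxE sumr_ge0 // => j _.
by rewrite mxE -expr2 sqr_ge0.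
Qed.

Lemma frob_norm_sqr {R : realType} {m n : nat} (A : 'M[R]_(m, n)) :
  frob_norm A ^+ 2 = frob_dot A A.
Proof. by rewrite sqr_sqrtr ?frob_dot_ge0. Qed.

Lemma frob_normZ {R : realType} {m n : nat} (a : R) (A : 'M[R]_(m, n)) :
  0 <= a -> frob_norm (a *: A) = a * frob_norm A.
Proof.
move=> a0; rewrite /frob_norm frob_dotZl frob_dotZr mulrA -expr2.
by rewrite sqrtrM ?sqr_ge0 // sqrtr_sqr ger0_norm.
Qed.

(* Expand 0 <= |A - c B|^2: Cauchy-Schwarz itself is not needed. *)
Lemma frob_dot_le {R : realType} {m n : nat} (c : R) (A B : 'M[R]_(m, n)) :
  0 < c -> frob_norm A <= c * frob_norm B ->
  frob_dot A B <= c * frob_dot B B.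
Proof.
move=> c0 AB.
have AB2 : frob_dot A A <= c ^+ 2 * frob_dot B B.
  by rewrite -!frob_norm_sqr -exprMn lerXn2r // nnegrE ?mulr_ge0 ?sqrtr_ge0 ?ltW.
have := frob_dot_ge0 (A + (- c) *: B).
rewrite !(frob_dotDl, frob_dotDr, frob_dotZl, frob_dotZr) (frob_dotC B A) => D.
by rewrite -(ler_pM2l c0); nra.
Qed.

(** * Descent along a segment *)

(** The difference quotient of the restriction at [t] is that of [g] at [X + t *: V] in direction
    [V], so the directional derivative carries over without a chain rule. *)
Lemma is_derive_line {R : realType} {m n : nat} (g : 'M[R]_(m, n) -> R)
    (X V : 'M[R]_(m, n)) (t : R) :
  differentiable g (X + t *: V) ->
  is_derive t 1 (fun s => g (X + s *: V))
    (frob_dot (gradient g (X + t *: V)) V).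
Proof.
move=> dg; rewrite frob_dot_gradient // -deriveE //.
have quotE : (fun h : R => h^-1 *: (g (X + (h *: 1 + t) *: V) - g (X + t *: V)))
    = (fun h => h^-1 *: (g (h *: V + (X + t *: V)) - g (X + t *: V))).
  apply/funext => h; congr (_ *: (g _ - _)).
  by rewrite scalerDl addrCA [h *: 1]mulr1.
apply: DeriveDef; last by rewrite /derive /= quotE.
by rewrite /derivable /= quotE; exact: diff_derivable.
Qed.

(** The mean value theorem replaces integration of the gradient: [h] is [g] on the segment minus the
    linear and quadratic terms of the model, and its derivative at the mean value point is
    nonpositive, so [h 1 <= h 0]. *)
Lemma descent_inequality {R : realType} {m n : nat} (L : R)
    (g : 'M[R]_(m, n) -> R) (X V : 'M[R]_(m, n)) :
  0 < L -> (forall Y, differentiable g Y) ->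
  (forall Y Z, frob_norm (gradient g Y - gradient g Z)
               <= L * frob_norm (Y - Z)) ->
  g (X + V) <= g X + frob_dot (gradient g X) V + L / 2 * frob_dot V V.
Proof.
move=> L0 dg lipg.
pose a := frob_dot (gradient g X) V; pose b := L / 2 * frob_dot V V.
pose h (t : R) := g (X + t *: V) - (a * t + b * t ^+ 2).
pose dh (t : R) := frob_dot (gradient g (X + t *: V)) V - (a + b * (2 * t)).
have h_dh (t : R) : is_derive t 1 h (dh t).
  have line_t := is_derive_line g X V t (dg (X + t *: V)).
  apply: is_deriveB; apply: is_derive_eq.
  by rewrite /GRing.scale /=; ring.
have h_cont : {within `[0, 1], continuous h}%classic.
  apply: continuous_subspaceT => t; apply: differentiable_continuous.
  by apply/derivable1_diffP; case: (h_dh t).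
have [c] := @MVT _ h dh _ _ ltr01 (fun t _ => h_dh t) h_cont.
rewrite in_itv /= => /andP[c0 _].
(* [dh c] equals <grad g (X + c V) - grad g X, V> - L c |V|^2. The two gradients are taken at points
   c V apart, so [frob_dot_le] applies with constant [L * c], positive because [c] is interior. *)
have dhc : dh c <= 0.
  have := @frob_dot_le R m n (L * c)
    (gradient g (X + c *: V) - gradient g X) V (mulr_gt0 L0 c0).
  have /[swap]/[apply] : frob_norm (gradient g (X + c *: V) - gradient g X)
      <= L * c * frob_norm V.
    apply: le_trans (lipg _ _) _.
    by rewrite addrC addKr (frob_normZ _ _ (ltW c0)) mulrA.
  by rewrite -scaleN1r frob_dotDl frob_dotZl /dh /a /b; lra.
rewrite /h scale1r scale0r addr0 -/a -/b; lra.
Qed.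

(** * Orthonormal expansions and singular values *)

(** Parseval with two coefficient families: (sigma, 1), (1, 1) and (sigma, sigma) give <G, U>, |U|^2
    and |G|^2. *)
Lemma frob_dot_orthonormal {R : realType} {m n r : nat}
    (E : 'I_r -> 'M[R]_(m, n)) (a b : 'I_r -> R) :
  (forall i j, frob_dot (E i) (E j) = (i == j)%:R) ->
  frob_dot (\sum_i a i *: E i) (\sum_i b i *: E i) = \sum_i a i * b i.
Proof.
move=> orthoE; rewrite frob_dot_suml; apply: eq_bigr => i _.
rewrite frob_dotC frob_dot_suml (bigD1 i) //= frob_dotZl frob_dotZr orthoE eqxx.
rewrite mulr1 mulrC big1 ?addr0 // => j ji.
by rewrite frob_dotZl frob_dotZr orthoE (negbTE ji) !mulr0.
Qed.

Section CompactSvd.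
Context {R : realType} {m n : nat} {G : 'M[R]_(m, n)} (S : compact_svd G).
Let sigma i := tnth (sv S) i.

(** By cyclicity of the trace the product factors as (u_i . u_j) (v_i . v_j). *)
Lemma frob_dot_dyads i j :
  frob_dot (col i (lsv S) *m (col i (rsv S))^T)
           (col j (lsv S) *m (col j (rsv S))^T) = (i == j)%:R.
Proof.
rewrite /frob_dot trmx_mul trmxK mulmxA -(mulmxA _ _ (col j (lsv S))).
rewrite tr_col_lsv -mulmxA mxtrace_mulC -mulmxA tr_col_rsv.
rewrite mul_scalar_mx mxtraceZ mxtrace_scalar mulr1n.
by case: eqVneq; rewrite ?mul1r ?mul0r.
Qed.

Lemma orth_polar_dot : frob_dot G (orth_polar S) = \sum_i sigma i.
Proof.
rewrite {1}(svdE S).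
have -> : orth_polar S = \sum_i 1 *: (col i (lsv S) *m (col i (rsv S))^T).
  by apply: eq_bigr => i _; rewrite scale1r.
rewrite (frob_dot_orthonormal _ _ _ frob_dot_dyads).
by apply: eq_bigr => i _; rewrite mulr1.
Qed.

Lemma orth_polar_sqr :
  frob_dot (orth_polar S) (orth_polar S) = (\rank G)%:R.
Proof.
have -> : orth_polar S = \sum_i 1 *: (col i (lsv S) *m (col i (rsv S))^T).
  by apply: eq_bigr => i _; rewrite scale1r.
rewrite (frob_dot_orthonormal _ _ _ frob_dot_dyads).
by rewrite sumr_const card_ord mulr1.
Qed.

Lemma svd_sqr : frob_dot G G = \sum_i sigma i ^+ 2.
Proof.
by rewrite {1 2}(svdE S) (frob_dot_orthonormal _ _ _ frob_dot_dyads).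
Qed.

Lemma mxtrace_sym_polar : \tr (sym_polar S) = \sum_i sigma i.
Proof.
rewrite linear_sum; apply: eq_bigr => i _ /=.
by rewrite mxtraceZ mxtrace_mulC tr_col_rsv eqxx mxtrace_scalar mulr1.
Qed.

(** The squares are the diagonal terms of the expanded square of the sum; the cross terms are
    nonnegative. *)
Lemma frob_sqr_le_trace_sqr : frob_dot G G <= \tr (sym_polar S) ^+ 2.
Proof.
rewrite svd_sqr mxtrace_sym_polar expr2 mulr_suml; apply: ler_sum => i _.
rewrite expr2 ler_wpM2l ?(ltW (sv_gt0 S i)) // (bigD1 i) //= lerDl.
by apply: sumr_ge0 => j _; exact/ltW/sv_gt0.
Qed.

Lemma sv_nth_le (i j : nat) : (i <= j < \rank G)%N ->
  (sv S)`_j <= (sv S)`_i.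
Proof.
move=> /andP[ij jr].
apply: (sorted_leq_nth ge_trans ge_refl 0 (sv_sorted S)) => //;
  by rewrite inE size_tuple // (leq_ltn_trans ij).
Qed.

Lemma frob_sqr_le_cond : G != 0 ->
  frob_dot G G / svd_cond S ^+ 2 <= \tr (sym_polar S) ^+ 2 / (\rank G)%:R.
Proof.
rewrite -mxrank_eq0 -lt0n => r0.
have rR0 : 0 < (\rank G)%:R :> R by rewrite ltr0n.
(* Positive rank puts the positions 0 and [(\rank G).-1] in range, so [s1] and [sr] are true
   singular values and not the default 0. *)
have rP : ((\rank G).-1 < \rank G)%N by rewrite prednK.
set s1 := (sv S)`_0; set sr := (sv S)`_(\rank G).-1.
have nthE i : (sv S)`_(nat_of_ord i) = sigma i by rewrite /sigma (tnth_nth 0).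
have s1_gt0 : 0 < s1 by rewrite /s1 (nthE (Ordinal r0)) sv_gt0.
have sr_gt0 : 0 < sr by rewrite /sr (nthE (Ordinal rP)) sv_gt0.
have le_s1 i : sigma i <= s1 by rewrite -nthE sv_nth_le //=.
have ge_sr i : sr <= sigma i.
  by rewrite -nthE sv_nth_le // rP andbT -ltnS prednK.
have normG : frob_dot G G <= (\rank G)%:R * s1 ^+ 2.
  rewrite svd_sqr mulr_natl -[X in _ *+ X]card_ord -sumr_const.
  by apply: ler_sum => i _; rewrite lerXn2r // nnegrE ltW ?sv_gt0.
have trH : (\rank G)%:R * sr <= \tr (sym_polar S).
  rewrite mxtrace_sym_polar mulr_natl -[X in _ *+ X]card_ord -sumr_const.
  exact: ler_sum.
rewrite /svd_cond -/s1 -/sr exprMn exprVn invfM invrK mulrA.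
(* Both sides are compared with r sigma_r^2: [normG] bounds the left one, [trH] the right one. *)
apply: (@le_trans _ _ ((\rank G)%:R * sr ^+ 2)).
  by rewrite ler_wpM2r ?sqr_ge0 // ler_pdivrMr ?exprn_gt0.
rewrite ler_pdivlMr // mulrAC -expr2 -exprMn.
by rewrite lerXn2r // nnegrE ?mulr_ge0 ?ltW // (lt_le_trans _ trH) ?mulr_gt0.
Qed.

End CompactSvd.

(** * From descent to contraction *)

Lemma polar_step_decrease {R : realType} {m n : nat} (L : R)
    (g : 'M[R]_(m, n) -> R) (X : 'M[R]_(m, n))
    (S : compact_svd (gradient g X)) (r := (\rank (gradient g X))%:R : R)
    (s := \tr (sym_polar S)) :
  0 < L -> (forall Y, differentiable g Y) ->
  (forall Y Z, frob_norm (gradient g Y - gradient g Z)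
               <= L * frob_norm (Y - Z)) ->
  gradient g X != 0 ->
  g (X - (1 / (L * r) * s) *: orth_polar S) <= g X - s ^+ 2 / r / (2 * L).
Proof.
move=> L0 dg lipg; rewrite -mxrank_eq0 -lt0n => rank_gt0.
have r0 : 0 < r by rewrite ltr0n.
rewrite -scaleNr; apply: le_trans (descent_inequality _ _ _ _ L0 dg lipg) _.
rewrite !frob_dotZr !frob_dotZl orth_polar_dot orth_polar_sqr.
(* The model changes by - gamma s^2 + (L r / 2) gamma^2 s^2, which gamma = 1/(L r) minimizes; its
   value there is exactly the claimed decrease. *)
rewrite -mxtrace_sym_polar -/s -/r le_eqVlt; apply/orP; left; apply/eqP.
by field; rewrite !gt_eqF.
Qed.

(** Scalar core of both rates: [a] and [a'] are the gaps before and after the step, [N] is |G|^2,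
    [d] is (tr H)^2 / r, and [q] bounds d / N from below. *)
Lemma pl_contraction {R : realType} (L mu q d a a' N : R) :
  0 < L -> 0 <= q -> a' <= a - d / (2 * L) -> 2 * mu * a <= N -> N * q <= d ->
  a' <= (1 - q * (mu / L)) * a.
Proof.
move=> L0 q0 dec pl Nq.
apply: le_trans dec _.
rewrite mulrBl mul1r lerD2l lerN2 ler_pdivlMr ?mulr_gt0 //.
have -> : q * (mu / L) * a * (2 * L) = 2 * mu * a * q by field; rewrite gt_eqF.
by apply: le_trans Nq; rewrite ler_wpM2r.
Qed.

Theorem theorem3p2 (R : realType) (m n : nat) (n_ge1 : (1 <= n)%N)
    (le_n_m : (n <= m)%N) (f : 'M[R]_(m, n) -> \bar R) (L mu : R)
    (fstar : \bar R) (L_gt0 : 0 < L) (mu_gt0 : 0 < mu)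
    (f_smooth : lipschitz_smooth L f)
    (f_PL : polyak_lojasiewicz mu f fstar)
    (X : nat -> 'M[R]_(m, n)) :
  let kappaH := L / mu in
  let G := fun k => gradient (fine \o f) (X k) in
  let r := fun k => \rank (G k) in
  let gamma := fun k => 1 / (L * (r k)%:R) in
  forall svdG : (forall k, compact_svd (G k)),
  let U := fun k => orth_polar (svdG k) in
  let H := fun k => sym_polar (svdG k) in
  let kappaG := fun k => svd_cond (svdG k) in
  (forall k, X k.+1 = X k - (gamma k * \tr (H k)) *: U k) ->
  forall k, G k != 0 ->
    (f (X k.+1) - fstar
       <= (1 - 1 / ((r k)%:R * kappaH))%:E * (f (X k) - fstar))%E /\
    (f (X k.+1) - fstar
       <= (1 - 1 / (kappaG k ^+ 2 * kappaH))%:E * (f (X k) - fstar))%E.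
Proof.
move=> kappaH G r gamma svdG U H kappaG Xstep k Gk0.
have [f_fin df lipf] := f_smooth.
have [[[Xmin fXmin] _] pl] := f_PL.
(* An attained minimum of a finite-valued function is finite, so the extended-real inequalities
   reduce to real ones. *)
have fstar_fin : fstar \is a fin_num by rewrite -fXmin.
have gE Y : f Y = (fine (f Y))%:E by rewrite fineK.
have fstarE : fstar = (fine fstar)%:E by rewrite fineK.
have dec := polar_step_decrease _ _ _ (svdG k) L_gt0 df lipf Gk0.
rewrite /= -/(H k) -/(U k) -/(r k) -/(gamma k) -Xstep in dec.
have plk := pl (X k).
rewrite -/(G k) frob_norm_sqr gE fstarE -EFinB -EFinM lee_fin in plk.
(* Used with q = 1/r and with q = 1/kappaG^2. *)
have rate q : 0 <= q ->
    frob_dot (G k) (G k) * q <= \tr (H k) ^+ 2 / (r k)%:R ->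
    (f (X k.+1) - fstar <= (1 - q * (mu / L))%:E * (f (X k) - fstar))%E.
  move=> q0 Nq; rewrite (gE (X k.+1)) (gE (X k)) fstarE -!EFinB -EFinM lee_fin.
  by apply: pl_contraction Nq => //; first lra.
have r0 : 0 < (r k)%:R :> R by rewrite ltr0n lt0n mxrank_eq0.
have rateE q : 1 / (q * kappaH) = q^-1 * (mu / L).
  by rewrite div1r invfM invf_div.
split; rewrite rateE; apply: rate.
- by rewrite invr_ge0 ltW.
- by apply: ler_wpM2r (frob_sqr_le_trace_sqr _); rewrite invr_ge0 ltW.
- by rewrite invr_ge0 sqr_ge0.
- exact: frob_sqr_le_cond.
Qed.
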